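(* Let $n>1$ be an integer and $d>1$ a proper divisor of $n$. Let $p_1 = f(n)$, $p_i = f\left(\frac{n}{d}\right)$, and let $Q$ be the set of prime divisors of $n$ that do not divide $d$. If $Q$ is empty, or if $q := \min_{p\in Q} p$ satisfies $q > p_1\cdot p_i$, then $\omega(X_n(1,d)) = p_1\cdot p_i$.
   Context: For an integer $n>1$ and a set $D$ of positive proper divisors of $n$, the gcd-graph $X_n(D)$ has vertex set $\mathbb{Z}_n=\{0,1,\ldots,n-1\}$, and two distinct vertices $a,b$ are adjacent if and only if $\gcd(a-b,n)\in D$; $X_n(1,d)$ denotes $X_n(\{1,d\})$. For an integer $m>1$, $f(m)$ denotes the smallest prime divisor of $m$. $\omega$ denotes the clique number. *)

(* Defs.v *)
From mathcomp Require Import all_boot all_order all_algebra.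

Set Implicit Arguments.
Unset Strict Implicit.
Unset Printing Implicit Defensive.

(* A finite simple graph on T is a symmetric irreflexive relation on T. *)

Definition clique (T : finType) (e : rel T) (K : {set T}) : bool :=
  [forall x in K, forall y in K, (x != y) ==> e x y].

Definition clique_number (T : finType) (e : rel T) : nat :=
  \max_(K : {set T} | clique e K) #|K|.

(* Vertices are the representatives 0, ..., n-1 and `|a - b| is the absolute
   value of the integer difference, which has the same gcd with n as any
   representative of a - b modulo n. *)
Definition gcd_graph (n : nat) (D : {pred nat}) : rel 'I_n :=
  fun a b => (a != b) && (gcdn `|(a%:Z - b%:Z)%R|%N n \in D).

Lemma gcd_graph_irr (n : nat) (D : {pred nat}) : irreflexive (@gcd_graph n D).
Proof. by move=> a; rewrite /gcd_graph eqxx. Qed.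

Lemma gcd_graph_sym (n : nat) (D : {pred nat}) : symmetric (@gcd_graph n D).
Proof. by move=> a b; rewrite /gcd_graph eq_sym distnC. Qed.

Definition gcd_graph_1d (n d : nat) : rel 'I_n := @gcd_graph n (pred2 1 d).

Definition primes_not_dividing (n d : nat) : {pred nat} :=
  [pred p | [&& prime p, p %| n & ~~ (p %| d)]].

Definition is_min (A : {pred nat}) (q : nat) : Prop :=
  q \in A /\ forall p, p \in A -> q <= p.

(* Main.v *)
(* Upper bound: two vertices of a clique that agree modulo p1 differ by an
   amount whose gcd with n is d, so they are congruent modulo d and their
   quotients by d differ modulo the smallest prime factor of n / d.
   Lower bound: split n = nd * nQ, where nd collects the primes dividing d, and
   use the Chinese remainder theorem to find vertices congruent to r + d * s
   modulo nd and to r * pi + s modulo nQ, for r < p1 and s < pi.  The values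
   r * pi + s are distinct and smaller than all primes dividing nQ, so only nd
   matters, and there the difference has gcd d if r is fixed and 1 otherwise. *)
Require Import Defs.
From mathcomp Require Import all_boot all_order all_algebra.

Lemma dvdn_dist (m x y : nat) : (m %| `|(x%:Z - y%:Z)%R|%N) = (x == y %[mod m]).
Proof.
wlog le_yx : x y / y <= x.
  by move=> H; case: (leqP y x) => [/H//|/ltnW/H]; rewrite distnC eq_sym.
by rewrite distnEl // eqn_mod_dvd.
Qed.

(** A divisor of [m] sees only residues modulo [m], so each gcd divides the other. This lets a
    vertex built by the Chinese remainder theorem be replaced by its prescribed residue. *)
Lemma gcdn_dist_mod {m x y a b : nat} :
  x = a %[mod m] -> y = b %[mod m] ->
  gcdn `|(x%:Z - y%:Z)%R|%N m = gcdn `|(a%:Z - b%:Z)%R|%N m.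
Proof.
have half u v a' b' : u = a' %[mod m] -> v = b' %[mod m] ->
    gcdn `|(u%:Z - v%:Z)%R|%N m %| gcdn `|(a'%:Z - b'%:Z)%R|%N m.
  move=> ua vb; rewrite dvdn_gcd dvdn_gcdr andbT dvdn_dist.
  set g := gcdn _ m; have gm : g %| m by apply: dvdn_gcdr.
  rewrite -(modn_dvdm a' gm) -ua -(modn_dvdm b' gm) -vb !modn_dvdm //.
  by rewrite -dvdn_dist dvdn_gcdl.
by move=> xa yb; apply/eqP; rewrite eqn_dvd !half.
Qed.

Lemma coprime_no_prime (k m : nat) : 0 < m ->
  (forall p, prime p -> p %| m -> ~~ (p %| k)) -> coprime k m.
Proof.
move=> m_gt0 no_p; rewrite /coprime; apply: contraT => g_neq1.
have g_gt1 : 1 < gcdn k m.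
  by rewrite ltn_neqAle eq_sym g_neq1 gcdn_gt0 m_gt0 orbT.
have := no_p _ (pdiv_prime g_gt1).
have := pdiv_dvd (gcdn k m); rewrite dvdn_gcd => /andP[-> ->].
by move/(_ isT).
Qed.

(** A common prime [p] would give [a = b] modulo [p] with [a, b < B <= p], hence [a = b]. *)
Lemma coprime_dist (m B a b : nat) : 0 < m ->
  (forall p, prime p -> p %| m -> B <= p) ->
  a < B -> b < B -> a != b -> coprime `|(a%:Z - b%:Z)%R|%N m.
Proof.
move=> m_gt0 leB aB bB neq_ab.
apply: coprime_no_prime => // p pr_p pm; rewrite dvdn_dist.
by rewrite !modn_small // (leq_trans _ (leB p pr_p pm)).
Qed.

Lemma clique_gcd_graph_1d_le (n d : nat) (K : {set 'I_n}) :
  1 < n -> 0 < d -> d %| n -> d < n -> clique (@gcd_graph_1d n d) K ->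
  #|K| <= pdiv n * pdiv (n %/ d).
Proof.
move=> hn hd hdn hdlt /forall_inP clK.
have m_gt1 : 1 < n %/ d by rewrite ltn_divRL // mul1n.
pose h (x : 'I_n) : 'I_(pdiv n) * 'I_(pdiv (n %/ d)) :=
  (Ordinal (ltn_pmod x (pdiv_gt0 n)),
   Ordinal (ltn_pmod (x %/ d) (pdiv_gt0 (n %/ d)))).
have h_inj : {in K &, injective h}.
  move=> x y xK yK [/eqP xy1 /eqP xy2]; apply/eqP; apply: contraT => neq_xy.
  have /forall_inP/(_ y yK)/implyP/(_ neq_xy)/andP[_] := clK x xK.
  rewrite !inE => /orP[] /eqP gE.
    (* Gcd 1 is impossible, since equal first coordinates make [pdiv n] divide the difference. *)
    have : pdiv n %| 1 by rewrite -gE dvdn_gcd pdiv_dvd andbT dvdn_dist.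
    by rewrite dvdn1; have := prime_gt1 (pdiv_prime hn); case: eqP => // ->.
  have xyd : x = y %[mod d].
    by apply/eqP; rewrite -dvdn_dist -[X in X %| _]gE dvdn_gcdl.
  (* Gcd [d] is impossible too: equal second coordinates put an extra prime factor into the gcd. *)
  have : d * pdiv (n %/ d) %| d.
    rewrite -[X in _ %| X]gE dvdn_gcd; apply/andP; split; last first.
      by rewrite -[X in _ %| X](divnK hdn) mulnC dvdn_mul // pdiv_dvd.
    (* The equal remainders modulo [d] cancel, leaving [d] times the difference of the quotients. *)
    rewrite [X in Posz X](divn_eq x d) [X in (_ - Posz X)%R](divn_eq y d) xyd.
    rewrite distnDr !(mulnC _ d) !PoszM -GRing.mulrBr abszM.
    by rewrite dvdn_mul // dvdn_dist.
  rewrite -[X in _ %| X]muln1 dvdn_pmul2l // dvdn1.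
  by have := prime_gt1 (pdiv_prime m_gt1); case: eqP => // ->.
rewrite -(card_in_imset h_inj) (leq_trans (max_card _)) //.
by rewrite card_prod !card_ord.
Qed.

Lemma clique_number_gcd_graph_1d_ge (n d : nat) :
  1 < n -> 1 < d -> d %| n -> d < n ->
  (forall p, p \in primes_not_dividing n d -> pdiv n * pdiv (n %/ d) <= p) ->
  pdiv n * pdiv (n %/ d) <= clique_number (@gcd_graph_1d n d).
Proof.
move=> hn hd hdn hdlt Qge; set B := _ * _ in Qge *.
have n_gt0 : 0 < n by apply: ltnW.
have d_gt0 : 0 < d by apply: ltnW.
pose nd := n`_\pi(d); pose nQ := n`_(\pi(d)^').
have nE : nd * nQ = n by apply: partnC.
have nd_gt0 : 0 < nd by apply: part_gt0.
have nQ_gt0 : 0 < nQ by apply: part_gt0.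
have nd_n : nd %| n by apply: dvdn_part.
have nQ_n : nQ %| n by apply: dvdn_part.
have cop : coprime nd nQ by apply: coprime_partC.
have d_nd : d %| nd by rewrite -[X in X %| _](partn_pi d_gt0) partn_dvd.
have nQ_ge p : prime p -> p %| nQ -> B <= p.
  move=> pr_p pQ; apply: Qge; rewrite !inE pr_p (dvdn_trans pQ nQ_n) /=.
  have := pnatP _ nQ_gt0 (part_pnat (\pi(d)^') n) p pr_p pQ.
  by rewrite !inE mem_primes pr_p d_gt0.
have d_ge p : prime p -> p %| d -> pdiv n <= p.
  by move=> pr_p pd; rewrite pdiv_min_dvd ?prime_gt1 // (dvdn_trans pd).
(* Here [n %/ d] is [(nd %/ d) * nQ], so primes of [nd %/ d] are primes of [n %/ d]. *)
have m_ge p : prime p -> p %| nd %/ d -> pdiv (n %/ d) <= p.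
  move=> pr_p pd; rewrite pdiv_min_dvd ?prime_gt1 // (dvdn_trans pd) //.
  by rewrite -nE -divn_mulAC // dvdn_mulr.
have m_gt0 : 0 < nd %/ d by rewrite divn_gt0 // dvdn_leq.
pose x0 (t : 'I_(pdiv n) * 'I_(pdiv (n %/ d))) :=
  chinese nd nQ (t.1 + d * t.2) (t.1 * pdiv (n %/ d) + t.2).
pose x t : 'I_n := Ordinal (ltn_pmod (x0 t) n_gt0).
have xd t : x t = t.1 + d * t.2 %[mod nd].
  by rewrite /= modn_dvdm // chinese_modl.
have xQ t : x t = t.1 * pdiv (n %/ d) + t.2 %[mod nQ].
  by rewrite /= modn_dvdm // chinese_modr.
have code_lt (t : 'I_(pdiv n) * 'I_(pdiv (n %/ d))) :
    t.1 * pdiv (n %/ d) + t.2 < B.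
  rewrite (@leq_trans (t.1.+1 * pdiv (n %/ d))) ?leq_mul //.
  by rewrite mulSn addnC ltn_add2r.
have adj t u : t != u -> gcdn `|((x t)%:Z - (x u)%:Z)%R|%N n \in pred2 1 d.
  move=> neq_tu.
  have copQ : coprime `|((x t)%:Z - (x u)%:Z)%R|%N nQ.
    rewrite /coprime (gcdn_dist_mod (xQ t) (xQ u)).
    apply: (coprime_dist _ B) => //.
    apply: contraNneq neq_tu => e.
    (* The code is a two-digit expansion in base [pdiv (n %/ d)], so division recovers the leading
       digit. *)
    have divE (v : 'I_(pdiv n) * 'I_(pdiv (n %/ d))) :
      (v.1 * pdiv (n %/ d) + v.2) %/ pdiv (n %/ d) = v.1 :> nat.
      by rewrite divnMDl ?pdiv_gt0 // (divn_small (ltn_ord v.2)) addn0.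
    have e1 : t.1 = u.1 by apply: ord_inj; rewrite -(divE t) e divE.
    have e2 : t.2 = u.2 by apply: ord_inj; move: e; rewrite e1 => /addnI.
    by rewrite (surjective_pairing t) (surjective_pairing u) e1 e2.
  rewrite -[X in gcdn _ X]nE Gauss_gcdl //.
  rewrite (gcdn_dist_mod (xd t) (xd u)) !inE.
  have [e1|neq1] := eqVneq t.1 u.1.
    (* The difference modulo [nd] is [d * (t.2 - u.2)], whose second factor is coprime to
       [nd %/ d]. *)
    have neq2 : t.2 != u.2.
      apply: contraNneq neq_tu => e2.
      by rewrite (surjective_pairing t) (surjective_pairing u) e1 e2.
    rewrite e1 distnDl !PoszM -GRing.mulrBr abszM.
    rewrite -(divnK d_nd) (mulnC _ d) -muln_gcdr.
    have /eqP -> :=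
      coprime_dist _ _ _ _ m_gt0 m_ge (ltn_ord t.2) (ltn_ord u.2) neq2.
    by rewrite muln1 eqxx orbT.
  (* Every prime of [nd] divides [d], so modulo it only [t.1 - u.1] survives, and both digits are
     below [pdiv n <= p]. *)
  apply/orP; left; apply: coprime_no_prime => // p pr_p pnd.
  have pd : p %| d.
    have := pnatP _ nd_gt0 (part_pnat (\pi(d)) n) p pr_p pnd.
    by rewrite mem_primes => /and3P[].
  have modE a b : a + d * b = a %[mod p].
    by rewrite -modnDmr -modnMml (eqP pd) mul0n mod0n addn0.
  by rewrite dvdn_dist !modE !modn_small // (leq_trans _ (d_ge p pr_p pd)).
have x_inj : injective x.
  (* Coinciding vertices would have gcd [n], which is neither 1 nor [d]. *)
  move=> t u e; apply/eqP; apply: contraT => /adj.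
  rewrite e GRing.subrr gcd0n !inE (gtn_eqF hn) (gtn_eqF hdlt) //.
have clx : clique (@gcd_graph_1d n d) (x @: setT).
  apply/forall_inP => _ /imsetP[t _ ->]; apply/forall_inP => _ /imsetP[u _ ->].
  apply/implyP => neq; rewrite /gcd_graph_1d /gcd_graph neq /=.
  by apply: adj; apply: contraNneq neq => ->.
rewrite /clique_number; apply: leq_trans (leq_bigmax_cond _ clx).
by rewrite card_imset // cardsT card_prod !card_ord.
Qed.

Theorem theorem3p4 (n d : nat) (hn : 1 < n) (hd : 1 < d)
    (hdn : d %| n) (hd_proper : d < n) :
  let p1 := pdiv n in
  let pi := pdiv (n %/ d) in
  let Q := primes_not_dividing n d in
  Q =i pred0 \/ (exists2 q, is_min Q q & p1 * pi < q) ->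
  clique_number (@gcd_graph_1d n d) = p1 * pi.
Proof.
move=> p1 pi Q hQ; apply/eqP; rewrite eqn_leq; apply/andP; split.
  by apply/bigmax_leqP => K; apply: clique_gcd_graph_1d_le => //; apply: ltnW.
apply: clique_number_gcd_graph_1d_ge => // p pQ.
case: hQ => [Q0|[q [_ q_min] lt_q]]; first by rewrite -/Q Q0 in pQ.
exact: leq_trans (ltnW lt_q) (q_min p pQ).
Qed.
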